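(* Let $G$ be a finite group of order $n=|G|$ with an irreducible unitary representation on a $d$-dimensional Hilbert space $\mathcal{H}$ (the representing unitary of $g\in G$ is also denoted $g$). Let $\rho$ be a quantum state on $\mathcal{H}$ and consider the geometrically uniform ensemble $(\frac1n,\rho_g)_{g\in G}$ with $\rho_g=g\rho g^\dagger$. For $\alpha\ge1$ let $(M_g^{(\alpha)})_{g\in G}$ be the $\alpha$-power-PGM of this ensemble. Then, as $\alpha\to\infty$, the operators $M_g^{(\alpha)}$ converge for every $g\in G$, and the limits $\big(\lim_{\alpha\to\infty}M_g^{(\alpha)}\big)_{g\in G}$ form an optimal measurement for discriminating the ensemble.
   Context: A quantum state is a positive semidefinite operator of unit trace. For a general ensemble $(p_i,\rho_i)_i$ and $\alpha\ge 1$, the $\alpha$-power-PGM (power pretty good measurement) is $M_i^{(\alpha)}=\tilde\rho^{-1/2}(p_i\rho_i)^\alpha\tilde\rho^{-1/2}$ with $\tilde\rho=\sum_i(p_i\rho_i)^\alpha$, the inverse being taken on the support of $\tilde\rho$; here it is applied with index set $G$ and $p_g=\frac1n$. A POVM is a family $(M_g)_{g\in G}$ of positive semidefinite operators with $\sum_g M_g=\mathbb{I}$. A POVM is optimal for discriminating the ensemble if it maximizes the success probability $\frac1n\sum_{g\in G}\operatorname{tr}(M_g\rho_g)$ over all POVMs. *)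

(* Defs.v *)
From HB Require Import structures.
From mathcomp Require Import all_boot all_order all_algebra all_fingroup.
From mathcomp Require Import spectral mxrepresentation complex.
From mathcomp Require Import boolp classical_sets reals topology normedtype exp.
Import Order.TTheory GRing.Theory Num.Theory numFieldNormedType.Exports.

Set Implicit Arguments.
Unset Strict Implicit.
Unset Printing Implicit Defensive.

Local Open Scope classical_set_scope.
Local Open Scope ring_scope.
Local Open Scope complex_scope.
Local Open Scope sesquilinear_scope.

(* Naming R[i] as a numClosedFieldType lets matrices over it inherit the norm
   topology that numFieldNormedType gives to every numClosedFieldType; no
   topology is attached to the bare type R[i]. *)
Definition Cplx (R : realType) : numClosedFieldType := R[i].

Definition toC (R : realType) (x : R) : Cplx R := x%:C.

(* In the order of Cplx R, 0 <= z means that z is real and nonnegative. *)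
Definition psdmx (R : realType) d (A : 'M[Cplx R]_d) : Prop :=
  A \is hermsymmx /\ forall v : 'cV[Cplx R]_d, 0 <= (v^t* *m A *m v) 0 0.

Definition quantum_state (R : realType) d (rho : 'M[Cplx R]_d) : Prop :=
  psdmx rho /\ \tr rho = 1.

(* A^a by spectral calculus, for A positive semidefinite. Since 0 `^ a = 0 for
   a != 0, a negative exponent gives the power of the inverse of A taken on its
   support. For a normal A the value does not depend on the diagonalisation
   chosen by spectralmx. *)
Definition psdpow (R : realType) d (A : 'M[Cplx R]_d) (a : R) : 'M[Cplx R]_d :=
  invmx (spectralmx A)
  *m diag_mx (\row_j toC (complex.Re (spectral_diag A 0 j) `^ a))
  *m spectralmx A.

Section Discrimination.
Context (R : realType) (I : finType) (J : {set I}) (d : nat).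
Implicit Types (p : I -> R) (rho M : I -> 'M[Cplx R]_d).

Definition power_pgm p rho (a : R) (i : I) : 'M[Cplx R]_d :=
  let rho_tilde := \sum_(j in J) psdpow (toC (p j) *: rho j) a in
  psdpow rho_tilde (- 2^-1)
  *m psdpow (toC (p i) *: rho i) a
  *m psdpow rho_tilde (- 2^-1).

Definition povm M : Prop :=
  (forall i, i \in J -> psdmx (M i)) /\ \sum_(i in J) M i = 1%:M.

Definition success_prob p rho M : Cplx R :=
  \sum_(i in J) toC (p i) * \tr (M i *m rho i).

Definition optimal_povm p rho M : Prop :=
  povm M /\
  forall N, povm N -> success_prob p rho N <= success_prob p rho M.

End Discrimination.

Section GeometricallyUniform.
Context (R : realType) (gT : finGroupType) (G : {group gT}) (d : nat).

Definition gu_prior (g : gT) : R := #|G|%:R^-1.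

(* rG g acts on column vectors. Irreducibility in the sense of mx_irreducible is
   about row subspaces; for a unitary rG, v |-> v^t* matches the invariant row
   subspaces with the invariant column subspaces. *)
Definition gu_state (rG : mx_representation (Cplx R) G d)
    (rho : 'M[Cplx R]_d) (g : gT) : 'M[Cplx R]_d :=
  rG g *m rho *m (rG g)^t*.

End GeometricallyUniform.

(* Main.v *)
(* Let A = rho / n, with eigenvalues l_j in an orthonormal eigenbasis. By
   Schur's lemma the twirled operator sum_g g A^a g^* is (n / d) tr (A^a) times
   the identity, so M_g^(a) = (d / n) g (A^a / tr (A^a)) g^*. As a tends to
   infinity, the weights l_j^a / sum_k l_k^a converge to weights carried by the
   largest eigenvalue L of A. The limits therefore succeed with probability d L,
   whereas a POVM N succeeds with probability
   sum_g tr (N_g g A g^* ) <= L sum_g tr N_g = d L. *)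
Require Import Defs.
From HB Require Import structures.
From mathcomp Require Import all_boot all_order all_algebra all_fingroup.
From mathcomp Require Import spectral mxrepresentation complex.
From mathcomp Require Import boolp classical_sets reals topology normedtype.
From mathcomp Require Import sequences exp.
Import Order.TTheory GRing.Theory Num.Theory numFieldNormedType.Exports.
Local Open Scope classical_set_scope.
Local Open Scope ring_scope.
Local Open Scope sesquilinear_scope.

(** * Embedding of the reals into the complex numbers *)

HB.instance Definition _ (R : realType) :=
  GRing.RMorphism.copy (@toC R) (real_complex R).

Lemma toC_ge0 (R : realType) (x : R) : (0 <= toC x) = (0 <= x).
Proof. by rewrite /toC ler0c. Qed.

Lemma ler_toC (R : realType) (x y : R) : (toC x <= toC y) = (x <= y).
Proof. by rewrite /toC lecR. Qed.

Lemma conj_toC (R : realType) (x : R) : (toC x)^* = toC x.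
Proof. exact: conjc_real. Qed.

Lemma norm_toC (R : realType) (x : R) : `|toC x| = toC `|x|.
Proof. by rewrite /toC normc_def /= expr0n addr0 sqrtr_sqr. Qed.

Lemma cvg_toC {R : realType} {T : Type} (F : set_system T) {FF : Filter F}
    (f : T -> R) (l : R) :
  f x @[x --> F] --> l -> toC (f x) @[x --> F] --> toC l.
Proof.
move=> fl; apply/cvgrPdist_lt => e e0.
(* Positivity in the order of [Cplx R] forces [e] to be real, so its real part can serve as the
   tolerance in [R]. *)
have eE : e = toC (complex.Re e) by rewrite /toC RRe_real // gtr0_real.
have Re0 : 0 < complex.Re e by rewrite -ltcR -[X in _ < X]eE.
move/cvgrPdist_lt: fl => /(_ _ Re0); apply: filterS => x.
by rewrite -rmorphB norm_toC eE /toC ltcR.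
Qed.

(** * Unitary diagonalisation of complex matrices *)

Section Matrices.
Context {C : numClosedFieldType}.

(** The unitary W = U V^* intertwines the two diagonal matrices: a_i W_ij = W_ij b_j. Wherever W_ij
    is nonzero this gives a_i = b_j, hence f(a_i) = f(b_j), so W also intertwines the images under
    [f]. It frees [psdpow] from the basis chosen by [spectralmx]. *)
Lemma spectral_calculus_uniq d (f : C -> C) (U V : 'M[C]_d) (a b : 'rV[C]_d) :
    U \is unitarymx -> V \is unitarymx ->
    U^t* *m diag_mx a *m U = V^t* *m diag_mx b *m V ->
  U^t* *m diag_mx (map_mx f a) *m U = V^t* *m diag_mx (map_mx f b) *m V.
Proof.
move=> Uu Vu; have UU := unitarymxP Uu; have VV := unitarymxP Vu.
have UU' : U^t* *m U = 1%:M by apply/mulmx1C.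
have VV' : V^t* *m V = 1%:M by apply/mulmx1C.
move=> E; pose W := U *m V^t*.
have /matrixP WE : diag_mx a *m W = W *m diag_mx b.
  move/(congr1 (fun X => U *m X *m V^t*)): E.
  by rewrite !mulmxA UU mul1mx -!mulmxA VV mulmx1 !mulmxA.
have fW : diag_mx (map_mx f a) *m W = W *m diag_mx (map_mx f b).
  apply/matrixP => i j; have := WE i j.
  rewrite !mul_mx_diag !mul_diag_mx.
  rewrite ![(\matrix_(_, _) _) i j]mxE ![map_mx f _ _ _]mxE [_ * W i j]mulrC.
  have [->|W0 /(mulfI W0) ->] := eqVneq (W i j) 0.
    by rewrite mulr0 !mul0r.
  exact: mulrC.
have WV : W *m V = U by rewrite /W -mulmxA VV' mulmx1.
have UW : U^t* *m W = V^t* by rewrite /W mulmxA UU' mul1mx.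
by rewrite -{2}WV mulmxA -[_ *m _ *m W]mulmxA fW mulmxA UW.
Qed.

Lemma mulmx_conjT m n p (A : 'M[C]_(m, n)) (B : 'M[C]_(n, p)) :
  (A *m B)^t* = B^t* *m A^t*.
Proof. by rewrite trmx_mul map_mxM. Qed.

Lemma conj_diag_normal d (V : 'M[C]_d) b : V \is unitarymx ->
  V^t* *m diag_mx b *m V \is normalmx.
Proof.
move=> Vu; apply/orthomx_spectral_subproof.
by exists (V, b) => //=; rewrite invmx_unitary.
Qed.

(** Read as a value of the quadratic form of [A], such an entry is nonnegative as soon as [A] is
    positive semidefinite. *)
Lemma conj_diag_entry d (V : 'M[C]_d) (A : 'M[C]_d) j :
  (V *m A *m V^t*) j j =
  ((col j (V^t*))^t* *m A *m col j (V^t*)) 0 0.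
Proof.
rewrite colE mulmx_conjT trmxCK trmx_delta map_delta_mx !mulmxA -colE.
by rewrite -!mulmxA -rowE [in RHS]mxE [in RHS]mxE.
Qed.

End Matrices.

(** * Powers, traces and limits in a fixed eigenbasis *)

Section SpectralPower.
Context {R : realType} {d : nat}.
Local Notation C := (Cplx R).
Implicit Types (A N U V : 'M[C]_d) (l w : 'I_d -> R).

(* The Hermitian matrix whose eigenvectors are the conjugate-transposed rows of
   V, with real eigenvalues l. *)
Definition hermx V l : 'M[C]_d := V^t* *m diag_mx (\row_j toC (l j)) *m V.

Lemma psdpow_hermx V l a : V \is unitarymx ->
  psdpow (hermx V l) a = hermx V (fun j => l j `^ a).
Proof.
move=> Vu; have Su := spectral_unitarymx (hermx V l).
have /orthomx_spectralP := conj_diag_normal _ V (\row_j toC (l j)) Vu.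
rewrite -/(hermx V l) (invmx_unitary Su) => AE.
have := spectral_calculus_uniq _ (fun z : C => toC (complex.Re z `^ a)) _ _ _ _
  Su Vu (esym AE).
have mapE (b : 'rV[C]_d) : map_mx (fun z : C => toC (complex.Re z `^ a)) b =
    \row_j toC (complex.Re (b 0 j) `^ a).
  by apply/rowP => j; rewrite mxE mxE.
rewrite !mapE /psdpow (invmx_unitary Su) => ->.
rewrite /hermx (_ : \row_j _ = \row_j toC (l j `^ a)) //.
by apply/rowP => j; rewrite mxE mxE mxE.
Qed.

Lemma psdpow_scalar (x a : R) :
  psdpow ((toC x)%:M : 'M[C]_d) a = (toC (x `^ a))%:M.
Proof.
have E (y : R) : (toC y)%:M = hermx 1%:M (fun=> y).
  rewrite /hermx mulmx1 trmx1 map_mx1 mul1mx -diag_const_mx.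
  by congr diag_mx; apply/rowP => j; rewrite !mxE.
rewrite E psdpow_hermx -?E //.
by apply/unitarymxP; rewrite mul1mx trmx1 map_mx1.
Qed.

Lemma psdmx_diagonalization A : psdmx A ->
  exists U l, [/\ U \is unitarymx, forall j, 0 <= l j & A = hermx U l].
Proof.
move=> [Aherm Apos]; set U := spectralmx A.
have Uu : U \is unitarymx by exact: spectral_unitarymx.
have /hermitian_normalmx/orthomx_spectralP := Aherm.
rewrite -/U invmx_unitary // => AE.
(* Each eigenvalue is the quadratic form of [A] at its unit eigenvector; being nonnegative in
   [Cplx R], it is also real. *)
have D0 j : 0 <= spectral_diag A 0 j.
  have := Apos (col j (U^t*)); rewrite -conj_diag_entry [in X in X -> _]AE.
  rewrite !mulmxA (unitarymxP Uu) mul1mx -mulmxA (unitarymxP Uu) mulmx1.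
  by rewrite mxE eqxx.
have DE j : spectral_diag A 0 j = toC (complex.Re (spectral_diag A 0 j)).
  by rewrite /toC RRe_real // ger0_real.
exists U, (fun j => complex.Re (spectral_diag A 0 j)); split=> // [j|].
  by rewrite -toC_ge0 -DE.
rewrite [LHS]AE; congr (_ *m diag_mx _ *m _).
by apply/rowP => j; rewrite mxE -DE.
Qed.

Lemma scale_hermx (x : R) V l :
  toC x *: hermx V l = hermx V (fun j => x * l j).
Proof.
rewrite /hermx scalemxAl scalemxAr -linearZ; congr (_ *m diag_mx _ *m _).
by apply/rowP => j; rewrite !mxE rmorphM.
Qed.

Lemma conj_hermx U V l : U *m hermx V l *m U^t* = hermx (V *m U^t*) l.
Proof. by rewrite /hermx mulmx_conjT trmxCK !mulmxA. Qed.

Lemma mxtrace_mul_hermx N V l :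
  \tr (N *m hermx V l) = \sum_j toC (l j) * (V *m N *m V^t*) j j.
Proof.
rewrite /hermx mulmxA mxtrace_mulC !mulmxA mul_mx_diag /mxtrace.
by apply: eq_bigr => j _; rewrite mxE [X in _ * X]mxE mulrC.
Qed.

Lemma mxtrace_hermx V l : V \is unitarymx ->
  \tr (hermx V l) = toC (\sum_j l j).
Proof.
move=> Vu; rewrite -[hermx V l]mul1mx mxtrace_mul_hermx rmorph_sum.
apply: eq_bigr => j _.
by rewrite mulmx1 (unitarymxP Vu) !mxE eqxx mulr1.
Qed.

Lemma mxtrace_hermxM V w l : V \is unitarymx ->
  \tr (hermx V w *m hermx V l) = toC (\sum_j w j * l j).
Proof.
move=> Vu; rewrite mxtrace_mul_hermx rmorph_sum; apply: eq_bigr => j _.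
rewrite /hermx !mulmxA (unitarymxP Vu) mul1mx -mulmxA (unitarymxP Vu) mulmx1.
by rewrite !mxE eqxx mulr1n mulrC rmorphM.
Qed.

Lemma psdmx_hermx V l : (forall j, 0 <= l j) -> psdmx (hermx V l).
Proof.
move=> l0; split=> [|v].
  apply/is_hermitianmxP; rewrite expr0 scale1r /hermx !mulmx_conjT trmxCK.
  rewrite mulmxA; congr (_ *m _ *m _).
  rewrite tr_diag_mx map_diag_mx; congr diag_mx.
  by apply/rowP => j; rewrite !mxE; apply/esym/conj_toC.
rewrite /hermx !mulmxA -mulmx_conjT -mulmxA mul_mx_diag mxE.
apply: sumr_ge0 => j _; rewrite !mxE mulrAC mulr_ge0 ?toC_ge0 //.
by rewrite mulrC mul_conjC_ge0.
Qed.

(** In the eigenbasis, the left side is a combination of the diagonal entries of V N V^* with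
    coefficients [l j]. These entries are nonnegative and sum to the trace of [N]. *)
Lemma le_mxtrace_mul_hermx N V l (x : R) : V \is unitarymx -> psdmx N ->
  (forall j, l j <= x) -> \tr (N *m hermx V l) <= toC x * \tr N.
Proof.
move=> Vu [_ N0] lx.
have -> : \tr N = \tr (V *m N *m V^t*).
  by rewrite -mulmxA mxtrace_mulC -mulmxA (mulmx1C (unitarymxP Vu)) mulmx1.
rewrite mxtrace_mul_hermx mulr_sumr; apply: ler_sum => j _.
by rewrite ler_wpM2r ?ler_toC // conj_diag_entry.
Qed.

(** [hermx V] is linear in the eigenvalues: a finite sum of fixed matrices with scalar coefficients,
    so convergence of the coefficients suffices. *)
Lemma cvg_hermx {T : Type} (F : set_system T) {FF : Filter F} V
    (l : T -> 'I_d -> R) w :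
  (forall j, l x j @[x --> F] --> w j) ->
  hermx V (l x) @[x --> F] --> hermx V w.
Proof.
move=> lw.
have E k : hermx V k = \sum_j toC (k j) *: (V^t* *m delta_mx j j *m V).
  rewrite /hermx diag_mx_sum_delta mulmx_sumr mulmx_suml.
  by apply: eq_bigr => j _; rewrite mxE -scalemxAr -scalemxAl.
rewrite E; under eq_fun do rewrite E.
apply: cvg_big => [|j _]; first exact: add_continuous.
by apply: cvgZ; [apply: cvg_toC; exact: lw | exact: cvg_cst].
Qed.

End SpectralPower.

(** * Limits of normalised powers *)

Section PowerWeights.
Context {R : realType}.

Lemma cvgr_powR_lt1 (r : R) : 0 <= r < 1 -> r `^ a @[a --> +oo%R] --> 0.
Proof.
case/andP => + r1; rewrite le_eqVlt => /predU1P[<-|r0].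
  (* For r = 0 the power vanishes except at a = 0, so it is only eventually constant. *)
  by apply: cvg_near_cst; near=> a; rewrite powR0 // gt_eqF.
rewrite (_ : powR r = fun a => expR (- (a * - ln r))); last first.
  by apply/funext => a; rewrite /powR gt_eqF // mulrN opprK.
apply: (@cvg_comp _ _ _ (fun a => a * - ln r) (fun x => expR (- x))
  _ +oo%R); last exact: cvgr_expR.
by apply: gt0_cvgMly => //; rewrite oppr_gt0 ln_lt0 // r0.
Unshelve. all: by end_near.
Qed.

(** Dividing numerator and denominator by the power of the largest value [l m] leaves ratios in
    [0, 1], whose powers tend to 1 at the maximisers and to 0 elsewhere. The limit is thus the
    uniform distribution on the maximisers. *)
Lemma cvg_power_weights (I : finType) (l : I -> R) :
    (forall j, 0 <= l j) -> (exists j, 0 < l j) ->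
  exists w : I -> R,
    [/\ forall j, l j `^ a / (\sum_k l k `^ a) @[a --> +oo%R] --> w j,
        forall j, 0 <= w j, \sum_j w j = 1 &
        forall j, w j != 0 -> forall k, l k <= l j].
Proof.
move=> l0 [j1 lj1].
have [m lm] : exists m, forall k, l k <= l m.
  case: (@arg_maxP _ _ _ j1 xpredT l isT) => m _ lm.
  by exists m => k; exact: lm.
have m0 : 0 < l m by exact: lt_le_trans lj1 (lm _).
pose e j : R := (l j == l m)%:R.
have re j : (l j / l m) `^ a @[a --> +oo%R] --> e j.
  rewrite /e; have [->|lj] := eqVneq (l j) (l m).
    by rewrite divff ?gt_eqF // powR1; exact: cvg_cst.
  apply: cvgr_powR_lt1; rewrite divr_ge0 ?l0 //= ltr_pdivrMr // mul1r.
  by rewrite lt_neqAle lj lm.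
have s0 : 0 < \sum_k e k.
  by rewrite (bigD1 m) //= /e eqxx ltr_pwDl // sumr_ge0.
exists (fun j => e j / \sum_k e k); split=> [j|j||j].
- rewrite (_ : (fun a => _) =
      fun a => (l j / l m) `^ a / \sum_k (l k / l m) `^ a); last first.
    apply/funext => a.
    have E k : l k `^ a = l m `^ a * (l k / l m) `^ a.
      by rewrite -powRM ?divr_ge0 // mulrC divfK // gt_eqF.
    rewrite [in LHS]E; under [in LHS]eq_bigr do rewrite E.
    by rewrite -mulr_sumr -mulf_div divff ?mul1r // gt_eqF // powR_gt0.
  apply: cvgM; first exact: re.
  apply: cvgV; first by rewrite gt_eqF.
  by apply: cvg_big => [|k _]; [exact: add_continuous | exact: re].
- by rewrite divr_ge0 ?ler0n // ltW.
- by rewrite -mulr_suml divff // gt_eqF.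
- rewrite mulf_eq0 negb_or => /andP[+ _] k.
  by rewrite /e pnatr_eq0 eqb0 negbK => /eqP ->; exact: lm.
Qed.

End PowerWeights.

(** * Schur's lemma and the twirl over the group *)

Section Twirl.
Context {C : numClosedFieldType} {gT : finGroupType} {G : {group gT}} {d : nat}.
Context (rG : mx_representation C G d).

Lemma irr_dim_gt0 : mx_irreducible rG -> (0 < d)%N.
Proof.
case=> _ + _; rewrite lt0n; apply: contra_neq => d0.
by move: rG; rewrite d0 => _; apply: flatmx0.
Qed.

(** Over an algebraically closed field [A] has an eigenvalue c. Then A - c commutes with the
    representation and is singular, so by Schur's lemma it is zero. *)
Lemma irr_centgmx_scalar (A : 'M[C]_d) : mx_irreducible rG ->
  centgmx rG A -> exists c, A = c%:M.
Proof.
move=> irrG cA; have [c cP] := eigenvalue_closed A (irr_dim_gt0 irrG).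
exists c; apply/eqP; rewrite -subr_eq0; apply: contraT => nz.
have cB : centgmx rG (A - c%:M).
  apply/centgmxP => g Gg; rewrite mulmxBl mulmxBr (centgmxP cA) //.
  by rewrite scalar_mxC.
have := mx_Schur irrG cB nz; rewrite -row_free_unit -kermx_eq0.
by move: cP; rewrite /eigenvalue /eigenspace => /negPf ->.
Qed.

Lemma twirl_scalar (A : 'M[C]_d) : (forall g, g \in G -> rG g \is unitarymx) ->
    mx_irreducible rG ->
  \sum_(g in G) rG g *m A *m (rG g)^t* = (#|G|%:R * \tr A / d%:R)%:M.
Proof.
move=> Gu irrG; set T := LHS; have d0 := irr_dim_gt0 irrG.
have cT : centgmx rG T.
  apply/centgmxP => h Gh; rewrite mulmx_suml mulmx_sumr.
  (* Substituting hg for g in the sum on the left pulls out h on the left, and the trailing h^*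
     cancels against h. *)
  rewrite (reindex_inj (mulgI h)) /=.
  apply: eq_big => [g|g Gg]; first by rewrite groupMl.
  have {}Gg : g \in G by rewrite groupMl in Gg.
  rewrite repr_mxM // mulmx_conjT -!mulmxA.
  by rewrite (mulmx1C (unitarymxP (Gu h Gh))) mulmx1.
have [c Tc] := irr_centgmx_scalar _ irrG cT; rewrite Tc; congr (_%:M).
(* The scalar is found from the trace, since each conjugate of [A] has the trace of [A]. *)
have trT : \tr T = #|G|%:R * \tr A.
  rewrite /T raddf_sum /= (eq_bigr (fun=> \tr A)) ?sumr_const ?mulr_natl //.
  move=> g Gg; rewrite -mulmxA mxtrace_mulC -mulmxA.
  by rewrite (mulmx1C (unitarymxP (Gu g Gg))) mulmx1.
by rewrite -trT Tc mxtrace_scalar -[c *+ d]mulr_natr mulfK // pnatr_eq0 -lt0n.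
Qed.

End Twirl.

(** * Measurements along the orbit of a diagonalised operator *)

Section GeometricallyUniformPGM.
Context {R : realType} {gT : finGroupType} {G : {group gT}} {d : nat}.
Context (rG : mx_representation (Cplx R) G d).
Context (rG_unitary : forall g, g \in G -> rG g \is unitarymx).
Context (rG_irr : mx_irreducible rG).
Context (U : 'M[Cplx R]_d) (U_unitary : U \is unitarymx).
(** If [U] diagonalises an operator, then [V g] diagonalises its conjugate by [rG g], with the same
    eigenvalues. *)
Let V g := U *m (rG g)^t*.
Let n : R := #|G|%:R.

Let V_unitary g : g \in G -> V g \is unitarymx.
Proof. by move=> Gg; rewrite mul_unitarymx ?trmxC_unitary ?rG_unitary. Qed.

Lemma sum_orbit_hermx (l : 'I_d -> R) :
  \sum_(g in G) hermx (V g) l = (toC (n * (\sum_j l j) / d%:R))%:M.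
Proof.
under eq_bigr do rewrite -conj_hermx.
rewrite twirl_scalar // mxtrace_hermx //; congr (_%:M).
by rewrite fmorph_div rmorphM !rmorph_nat.
Qed.

Lemma power_pgm_orbit (p : gT -> R) (rho_ : gT -> 'M[Cplx R]_d) (l : 'I_d -> R)
    (a : R) (g : gT) :
    (forall j, 0 <= l j) -> (exists j, 0 < l j) ->
    (forall h, h \in G -> toC (p h) *: rho_ h = hermx (V h) l) -> g \in G ->
  power_pgm G p rho_ a g =
  hermx (V g) (fun j => d%:R / n * (l j `^ a / \sum_k l k `^ a)).
Proof.
move=> l0 [j1 lj1] rhoE Gg; rewrite /power_pgm.
have powE h : h \in G ->
    psdpow (toC (p h) *: rho_ h) a = hermx (V h) (fun j => l j `^ a).
  by move=> Gh; rewrite (rhoE h Gh) (psdpow_hermx _ _ _ (V_unitary h Gh)).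
rewrite (eq_bigr _ powE) sum_orbit_hermx psdpow_scalar powE //.
set s := \sum_k l k `^ a; set c := n * s / d%:R.
have c0 : 0 <= c.
  rewrite divr_ge0 ?ler0n // mulr_ge0 ?ler0n // sumr_ge0 // => k _.
  exact: powR_ge0.
rewrite mul_scalar_mx mul_mx_scalar scalerA -rmorphM scale_hermx.
(* The normaliser is the scalar [c], so the two outer factors c^(-1/2) merge into 1/c. *)
rewrite powRN (powR12_sqrt c0) -invfM -expr2 (sqr_sqrtr c0).
congr hermx; apply/funext => j.
by rewrite /c invf_div invfM -!mulrA [s^-1 * _]mulrC.
Qed.

Lemma orbit_povm (w : 'I_d -> R) : (forall j, 0 <= w j) -> \sum_j w j = 1 ->
  povm G (fun g => hermx (V g) (fun j => d%:R / n * w j)).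
Proof.
move=> w0 w1; split=> [g _|].
  by apply: psdmx_hermx => j; rewrite mulr_ge0 ?divr_ge0 ?ler0n.
rewrite sum_orbit_hermx -mulr_sumr w1 mulr1 mulrCA divff.
  by rewrite mulr1 divff ?rmorph1 // pnatr_eq0 -lt0n (irr_dim_gt0 rG).
by rewrite pnatr_eq0 -lt0n cardG_gt0.
Qed.

Lemma orbit_optimal (p : gT -> R) (rho_ M : gT -> 'M[Cplx R]_d)
    (l w : 'I_d -> R) :
    (forall h, h \in G -> toC (p h) *: rho_ h = hermx (V h) l) ->
    (forall j, 0 <= w j) -> \sum_j w j = 1 ->
    (forall j, w j != 0 -> forall k, l k <= l j) ->
    (forall g, g \in G -> M g = hermx (V g) (fun j => d%:R / n * w j)) ->
  optimal_povm G p rho_ M.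
Proof.
move=> rhoE w0 w1 wl ME; split.
  have [psd sum1] := orbit_povm _ w0 w1; split=> [g Gg|].
    by rewrite (ME g Gg); exact: psd.
  by rewrite (eq_bigr _ ME).
(* The weights sum to 1, so one of them is nonzero; its index [j] makes [l j] the largest
   eigenvalue. *)
have [j wj] : exists j, w j != 0.
  apply/existsP; apply: contraT => /existsPn /= w_eq0.
  have /eqP := w1; rewrite big1 => [|j _]; first by rewrite eq_sym oner_eq0.
  by apply/eqP; have := w_eq0 j; rewrite negbK.
(* Every index of nonzero weight attains the same maximum, so the eigenvalue can be replaced by
   [l j] under the weights. *)
have wlE k : w k * l k = w k * l j.
  have [->|wk] := eqVneq (w k) 0; first by rewrite !mul0r.
  by congr (_ * _); apply/le_anti; rewrite wl //= wl.
have succE N :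
    success_prob G p rho_ N = \sum_(g in G) \tr (N g *m hermx (V g) l).
  by apply: eq_bigr => g Gg; rewrite -rhoE // -scalemxAr mxtraceZ.
move=> N [N_psd N1]; rewrite !succE.
have d0 := irr_dim_gt0 rG rG_irr.
have -> : \sum_(g in G) \tr (M g *m hermx (V g) l) = toC (l j * d%:R).
  rewrite (eq_bigr (fun=> toC (d%:R / n * l j))) => [|g Gg].
    rewrite sumr_const -rmorphMn -mulr_natl mulrA mulrCA divff ?mulr1.
      by rewrite mulrC.
    by rewrite pnatr_eq0 -lt0n cardG_gt0.
  rewrite ME // mxtrace_hermxM ?V_unitary //; congr toC.
  under eq_bigr => k _ do rewrite -[_ * w k * _]mulrA wlE.
  by rewrite -mulr_sumr -mulr_suml w1 mul1r.
apply: (le_trans (y := \sum_(g in G) toC (l j) * \tr (N g))).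
  apply: ler_sum => g Gg.
  apply: le_mxtrace_mul_hermx; [exact: V_unitary|exact: N_psd|exact: wl].
by rewrite -mulr_sumr -raddf_sum /= N1 mxtrace1 rmorphM rmorph_nat.
Qed.

End GeometricallyUniformPGM.

(** * Limit and optimality for the orbit of a quantum state *)

Theorem proposition9 (R : realType) (gT : finGroupType) (G : {group gT})
    (d : nat) (rG : mx_representation (Cplx R) G d) (rho : 'M[Cplx R]_d)
    (rG_unitary : forall g, g \in G -> rG g \is unitarymx)
    (rG_irr : mx_irreducible rG)
    (rho_state : quantum_state rho) :
  let p := @gu_prior R gT G in
  let rho_ := gu_state rG rho in
  let M := fun (alpha : R) (g : gT) => power_pgm G p rho_ alpha g in
  (forall g, g \in G -> cvg (M alpha g @[alpha --> +oo%R]))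
  /\ optimal_povm G p rho_ (fun g => lim (M alpha g @[alpha --> +oo%R])).
Proof.
move=> p rho_ M.
have [/psdmx_diagonalization[U [mu [Uu mu0 rhoU]]] rho1] := rho_state.
pose V g := U *m (rG g)^t*; pose l j := #|G|%:R^-1 * mu j.
have n0 : 0 < #|G|%:R^-1 :> R by rewrite invr_gt0 ltr0n cardG_gt0.
have l0 j : 0 <= l j by rewrite mulr_ge0 // ltW.
(* Otherwise all eigenvalues of [rho] would vanish, contradicting its unit trace. *)
have l_pos : exists j, 0 < l j.
  apply/existsP; apply: contraT => /existsPn /= l_le0.
  have /eqP := rho1; rewrite rhoU mxtrace_hermx // big1 => [|j _].
    by rewrite rmorph0 eq_sym oner_eq0.
  apply/eqP; rewrite eq_le mu0 andbT -(pmulr_rle0 _ n0) leNgt; exact: l_le0.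
have rhoE h : h \in G -> toC (p h) *: rho_ h = hermx (V h) l.
  by move=> Gh; rewrite /rho_ /gu_state rhoU conj_hermx scale_hermx.
have [w [lw w0 w1 wl]] := cvg_power_weights _ _ l0 l_pos.
have Mw g : g \in G -> M alpha g @[alpha --> +oo%R] -->
    hermx (V g) (fun j => d%:R / #|G|%:R * w j).
  move=> Gg; rewrite (_ : M^~ g = fun a => hermx (V g)
      (fun j => d%:R / #|G|%:R * (l j `^ a / \sum_k l k `^ a))).
    by apply: cvg_hermx => j; apply: cvgM; [exact: cvg_cst | exact: lw].
  by apply/funext => a; exact: power_pgm_orbit.
split=> [g Gg|]; first by apply: cvgP; exact: Mw.
apply: (orbit_optimal rG rG_unitary rG_irr U Uu p rho_ _ l w) => // g Gg.
(* Limits of matrices are unique, so [lim] is the limit computed in [Mw]. *)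
by apply: cvg_lim; [exact: norm_hausdorff | exact: Mw].
Qed.
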